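(* There exist $N_1,N_2\in(0,\infty)$, with $N_1<2<N_2$, such that for all $\Pi_1,\Pi_4\in(0,\infty)$ the following hold for the boundary value problem $$\frac{d^2y}{d\eta^2}+\frac{2}{\eta}\frac{dy}{d\eta}+\Pi_1e^{y}=0 \quad (0<\eta\le \Pi_4),\qquad \left.\frac{dy}{d\eta}\right|_{\eta=0}=0,\qquad \left.\frac{dy}{d\eta}\right|_{\eta=\Pi_4}=-\frac{N}{\Pi_4}$$ with parameter $N\in(0,\infty)$: (a) the problem has solutions if and only if $N\le N_2$; (b) the problem has a unique solution if and only if $0<N<N_1$; (c) the number of solutions to the problem tends to infinity as $N\to2$.
   Context: Solutions are real-valued and classical: a solution $y$ is $C^1$ on $[0,\Pi_4]$, twice differentiable on $(0,\Pi_4]$, satisfies the differential equation for $0<\eta\le\Pi_4$ and the two derivative conditions at the endpoints. Statement (c) means: for every positive integer $K$ there is $\delta>0$ such that the problem has at least $K$ distinct solutions whenever $0<|N-2|<\delta$.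
   Formalization: Clause (b) is corrected: the problem has a unique solution if and only if 0 < N < N_1 or N = N_2, since at N = N_2 > N_1 the solution is also unique, so (b) as printed is false. *)

(* Defs.v *)
From Stdlib Require Import Reals.
Local Open Scope R_scope.

(* Functions on [0, P4] are represented by functions R -> R whose values off
   the interval are irrelevant. Derivatives and continuity are taken relative
   to the interval (D_in, continue_in), hence one-sided at its endpoints. *)
Definition dom (P4 x : R) : Prop := 0 <= x <= P4.

Definition is_solution (P1 P4 N : R) (y : R -> R) : Prop :=
  exists y1 y2 : R -> R,
    (forall x, dom P4 x -> D_in y y1 (dom P4) x /\ continue_in y1 (dom P4) x) /\
    (forall x, 0 < x <= P4 ->
       D_in y1 y2 (dom P4) x /\
       y2 x + 2 / x * y1 x + P1 * exp (y x) = 0) /\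
    y1 0 = 0 /\
    y1 P4 = - (N / P4).

Definition same_on (P4 : R) (y z : R -> R) : Prop :=
  forall x, dom P4 x -> y x = z x.

Definition has_solution (P1 P4 N : R) : Prop :=
  exists y, is_solution P1 P4 N y.

Definition has_unique_solution (P1 P4 N : R) : Prop :=
  exists y, is_solution P1 P4 N y /\
    forall z, is_solution P1 P4 N z -> same_on P4 y z.

Definition has_at_least_solutions (K : nat) (P1 P4 N : R) : Prop :=
  exists ys : nat -> R -> R,
    (forall i, (i < K)%nat -> is_solution P1 P4 N (ys i)) /\
    (forall i j, (i < K)%nat -> (j < K)%nat -> i <> j ->
       ~ same_on P4 (ys i) (ys j)).

(* Main.v *)
Require Import Defs.
From Stdlib Require Import Reals Lra Lia Classical.
From Coquelicot Require Import Coquelicot.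
Open Scope R_scope.

(* By scaling, the regular solutions of the equation are y(x) = c + w(l x) with
   P1 e^c = l^2, where w is the solution with w(0) = w'(0) = 0; so the solutions
   for the parameter N correspond to the s = l P4 > 0 with -s w'(s) = N. In the
   variable t = ln s, u = -s w' and v = s^2 e^w satisfy u' = v - u and
   v' = v (2 - u), and z = ln (v/2) is a damped oscillator:
   z' = 2 - u, z'' + z' + 2 (e^z - 1) = 0. Its energy decreases and, at a critical
   point of u, where v = u, equals a function of u alone that decreases on (0,2]
   and increases on [2,oo). Hence the successive maxima of u decrease, the minima
   increase, and N2 and N1 are the first maximum and the first minimum. A Riccati
   argument shows that z vanishes at arbitrarily large t, so u oscillates around 2
   for ever. *)

(** Oscillation could fail in two ways. z could stay very negative, where (e^z - 1)/z is close to 0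
    and the Riccati estimate is lost; or the orbit could come to rest at the equilibrium. An energy
    bound at the first zero of z excludes the first from then on. The second is excluded because the
    energy decays no faster than e^(-2t), so it never vanishes. The extrema of u are not enumerated.
    An extremum over a crude compact interval is compared, through the energy, with any other
    critical point on the same side of 2, and this already makes it global on the range in question.
    N1 and N2 are read off a single orbit, and P1 and P4 enter only through the scaling; hence the
    two numbers can be fixed first. That every solution belongs to the scaling family rests on
    uniqueness for an initial value problem that is singular at 0, so both existence and uniqueness
    there get their own proofs. *)

(** * Calculus *)

(* auto_derive leaves derivatives of eta-expanded functions. *)
Ltac rewrite_derive H :=
  match type of H with
  | is_derive ?f ?x ?l => rewrite (is_derive_unique (fun y : R => f y) x l H)
  end.

Lemma is_derive_cont (f : R -> R) (x l : R) : is_derive f x l -> continuity_pt f x.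
Proof.
  intros H. apply derivable_continuous_pt. exists l. now apply is_derive_Reals.
Qed.

Lemma mean_value (f f' : R -> R) (a b : R) :
  a < b -> (forall x, a <= x <= b -> is_derive f x (f' x)) ->
  exists c, a < c < b /\ f b - f a = f' c * (b - a).
Proof.
  intros Hab H. destruct (MVT_cor2 f f' a b Hab) as [c [E I]].
  - intros c Hc. apply is_derive_Reals. auto.
  - exists c; auto.
Qed.

Lemma nondecreasing_of_derive (f f' : R -> R) (a b : R) :
  a <= b -> (forall x, a <= x <= b -> is_derive f x (f' x)) ->
  (forall x, a < x < b -> 0 <= f' x) -> f a <= f b.
Proof.
  intros Hab H Hp. destruct (Req_dec a b) as [->|n]; [lra|].
  destruct (mean_value f f' a b) as [c [I E]]; [lra|auto|].
  specialize (Hp c I). nra.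
Qed.

Lemma increasing_of_derive (f f' : R -> R) (a b : R) :
  a < b -> (forall x, a <= x <= b -> is_derive f x (f' x)) ->
  (forall x, a < x < b -> 0 < f' x) -> f a < f b.
Proof.
  intros Hab H Hp. destruct (mean_value f f' a b) as [c [I E]]; [lra|auto|].
  specialize (Hp c I). nra.
Qed.

Lemma ivt_value (f : R -> R) (a b y : R) :
  a <= b -> (forall x, continuity_pt f x) -> (f a - y) * (f b - y) <= 0 ->
  exists c, a <= c <= b /\ f c = y.
Proof.
  intros Hab Hc Hs.
  destruct (IVT_cor (fun x => f x - y) a b) as [c [I E]]; auto.
  - intro x. apply continuity_pt_minus; auto.
    apply continuity_pt_const. intros p q; reflexivity.
  - exists c; split; [auto|lra].
Qed.

(** The witness is the supremum of the points up to which [f] stays below [y]; continuity excludes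
    both [f c < y] and [f c > y]. *)
Lemma first_crossing (f : R -> R) (p q y : R) :
  p <= q -> (forall x, continuity_pt f x) -> f p < y -> y <= f q ->
  exists c, p < c <= q /\ f c = y /\ forall x, p <= x < c -> f x < y.
Proof.
  intros Hpq Hc Hp Hq.
  set (S := fun x => p <= x <= q /\ forall z, p <= z <= x -> f z < y).
  destruct (completeness S) as [c [Hub Hlub]].
  - exists q. intros x [Hx _]; lra.
  - exists p. split; [lra|]. intros z Hz. replace z with p by lra. auto.
  - assert (Hpc : p <= c).
    { apply Hub. split; [lra|]. intros z Hz. replace z with p by lra. auto. }
    assert (Hcq : c <= q) by (apply Hlub; intros x [Hx _]; lra).
    assert (Hbelow : forall x, p <= x < c -> f x < y).
    { intros x Hx. destruct (Rlt_le_dec (f x) y) as [h|h]; auto. exfalso.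
      assert (c <= x); [|lra]. apply Hlub. intros s [Hs1 Hs2].
      destruct (Rle_lt_dec s x); auto. specialize (Hs2 x). lra. }
    assert (Hle : f c <= y).
    { destruct (Rle_lt_dec (f c) y) as [h|h]; auto. exfalso.
      destruct (Hc c (f c - y)) as [d [Hd Hd2]]; [lra|].
      assert (p < c). { destruct (Req_dec p c) as [e|n]; [subst; lra|lra]. }
      set (x := Rmax p (c - d/2)).
      assert (Hx : p <= x < c /\ c - d/2 <= x).
      { unfold x, Rmax; destruct (Rle_dec p (c - d/2)); lra. }
      assert (Hb := Hbelow x (proj1 Hx)).
      assert (Hdist : Rabs (f x - f c) < f c - y).
      { apply (Hd2 x). split; [split; [exact I|lra]|].
        simpl; unfold Rdist. apply Rabs_def1; lra. }
      apply Rabs_def2 in Hdist. lra. }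
    assert (Hge : y <= f c).
    { destruct (Rle_lt_dec y (f c)) as [h|h]; auto. exfalso.
      destruct (Hc c (y - f c)) as [d [Hd Hd2]]; [lra|].
      assert (c < q). { destruct (Req_dec c q) as [e|n]; [subst; lra|lra]. }
      set (x := Rmin q (c + d/2)).
      assert (Hx : c < x <= q /\ x <= c + d/2).
      { unfold x, Rmin; destruct (Rle_dec q (c + d/2)); lra. }
      assert (x <= c); [|lra]. apply Hub. split; [lra|].
      intros s Hs. destruct (Rlt_le_dec s c) as [l|l]; [apply Hbelow; lra|].
      destruct (Req_dec c s) as [e|n]; [subst; auto|].
      assert (Hdist : Rabs (f s - f c) < y - f c).
      { apply (Hd2 s). split; [split; [exact I|auto]|].
        simpl; unfold Rdist. apply Rabs_def1; lra. }
      apply Rabs_def2 in Hdist. lra. }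
    exists c. repeat split; auto; try lra.
    destruct (Req_dec p c) as [e|n]; [subst; lra|lra].
Qed.

(** The level [m] keeps a maximum point off both ends, so Fermat's rule applies to it. *)
Lemma interior_max (f f' : R -> R) (a b m : R) :
  a <= b -> (forall x, is_derive f x (f' x)) -> f a < m -> f b < m ->
  (exists x, a <= x <= b /\ m <= f x) ->
  exists c, a < c < b /\ m <= f c /\ f' c = 0 /\
    forall x, a <= x <= b -> f x <= f c.
Proof.
  intros Hab Hd Ha Hb [x0 [Hx0 Hm]].
  destruct (continuity_ab_maj f a b Hab) as [c [Hc I]].
  { intros; eapply is_derive_cont; eauto. }
  assert (m <= f c) by (specialize (Hc x0 Hx0); lra).
  assert (a < c < b).
  { split; [destruct (Req_dec a c)|destruct (Req_dec c b)]; subst; lra. }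
  exists c; repeat split; try tauto.
  assert (pr : derivable_pt_lim f c (f' c)) by (apply is_derive_Reals; auto).
  assert (E := deriv_maximum f a b c (exist _ (f' c) pr)).
  simpl in E. apply E; try tauto. intros; apply Hc; lra.
Qed.

Lemma interior_min (f f' : R -> R) (a b m : R) :
  a <= b -> (forall x, is_derive f x (f' x)) -> m < f a -> m < f b ->
  (exists x, a <= x <= b /\ f x <= m) ->
  exists c, a < c < b /\ f c <= m /\ f' c = 0 /\
    forall x, a <= x <= b -> f c <= f x.
Proof.
  intros Hab Hd Ha Hb [x0 [Hx0 Hm]].
  destruct (interior_max (fun x => - f x) (fun x => - f' x) a b (- m))
    as [c [I [Hc [E Hmax]]]]; auto; try lra.
  - intro x. apply (is_derive_opp f x (f' x)). apply Hd.
  - exists x0; split; [auto|lra].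
  - exists c; repeat split; try tauto; try lra.
    intros x Hx. specialize (Hmax x Hx). lra.
Qed.

(** * The planar system *)

(* With s = e^t, u = - s w'(s) and v = s^2 e^(w(s)) turn the equation
   w'' + (2/s) w' + e^w = 0 into this autonomous system; the condition at -oo
   singles out the solutions that are regular at s = 0. *)
Definition emden_orbit (u v : R -> R) : Prop :=
  (forall t, is_derive u t (v t - u t)) /\
  (forall t, is_derive v t (v t * (2 - u t))) /\
  (forall t, 0 < u t) /\
  (forall t, 0 < v t) /\
  (forall eps, 0 < eps -> exists T, forall t, t <= T -> u t < eps /\ v t < eps).

Definition logv (v : R -> R) (t : R) : R := ln (v t / 2).

(** Kinetic part z'^2/2 plus the potential 2 (e^z - 1 - z), written with v = 2 e^z. *)
Definition energy (u v : R -> R) (t : R) : R :=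
  (2 - u t) ^ 2 / 2 + v t - 2 * logv v t - 2.

Definition crit_energy (x : R) : R := (2 - x) ^ 2 / 2 + x - 2 * ln (x / 2) - 2.

Lemma ln_le_sub1 (x : R) : 0 < x -> ln x <= x - 1.
Proof. intros Hx. assert (H := exp_ineq1_le (ln x)). rewrite exp_ln in H; lra. Qed.

Lemma ln_lt_sub1 (x : R) : 0 < x -> ln x <> 0 -> ln x < x - 1.
Proof. intros Hx Hn. assert (H := exp_ineq1 _ Hn). rewrite exp_ln in H; lra. Qed.

Lemma exp_logv (v : R -> R) (t : R) : 0 < v t -> v t = 2 * exp (logv v t).
Proof. intros H. unfold logv. rewrite exp_ln; lra. Qed.

(** Cubing [1 + x <= exp x] at x = -z/3 gives e^z <= (1 + x)^(-3), and (1 - 3x/4) (1 + x)^3 >= 1 on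
    [0,1]. *)
Lemma exp_le_chord (z : R) : -3 <= z <= 0 -> exp z <= 1 + z / 4.
Proof.
  intros Hz. set (x := - z / 3).
  assert (Hx : 0 <= x <= 1) by (unfold x; lra).
  assert (He := exp_ineq1_le x).
  assert (Hz3 : exp z * (exp x * exp x * exp x) = 1).
  { rewrite <- !exp_plus. replace (z + (x + x + x)) with 0 by (unfold x; field).
    apply exp_0. }
  assert (Hcube : (1 + x) * (1 + x) * (1 + x) <= exp x * exp x * exp x).
  { repeat apply Rmult_le_compat; nra. }
  assert (Hp := exp_pos z).
  replace z with (- 3 * x) at 2 by (unfold x; field).
  assert (H1 : exp z * ((1 + x) * (1 + x) * (1 + x)) <= 1) by nra.
  assert (H2 : 1 <= (1 + -3 * x / 4) * ((1 + x) * (1 + x) * (1 + x))).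
  { assert (0 <= x * (1-x)) by nra. assert (0 <= x * x * (1-x)) by nra. assert (0 <= x*x*x*(1-x)) by nra. nra. }
  assert (0 < (1 + x) * (1 + x) * (1 + x)) by (repeat apply Rmult_lt_0_compat; lra).
  apply Rmult_le_reg_r with ((1 + x) * (1 + x) * (1 + x)); lra.
Qed.

(** The constant 1/4 suits the Riccati estimate: r^2 + r + 2/4 is exactly a quarter of 1 + (2 r +
    1)^2, the denominator in the derivative of atan (2 r + 1). *)
Lemma exp_slope (z : R) : z <> 0 -> -3 < z -> 1 / 4 <= (exp z - 1) / z.
Proof.
  intros Hn Hz. destruct (Rlt_le_dec 0 z) as [h|h].
  - apply Rmult_le_reg_r with z; auto. unfold Rdiv at 2. rewrite Rmult_assoc, Rinv_l by lra.
    assert (H := exp_ineq1_le z). lra.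
  - assert (H := exp_le_chord z). replace ((exp z - 1) / z) with ((1 - exp z) / (- z)) by (field; lra).
    apply Rmult_le_reg_r with (- z); [lra|]. unfold Rdiv at 2. rewrite Rmult_assoc, Rinv_l by lra.
    lra.
Qed.

(** * Energy decay along orbits *)

Lemma is_derive_logv u v t : emden_orbit u v -> is_derive (logv v) t (2 - u t).
Proof.
  intros (Hu & Hv & Pu & Pv & _). specialize (Hv t). specialize (Pv t).
  unfold logv. evar_last. apply (is_derive_comp ln (fun x => v x / 2)).
  - apply is_derive_ln. lra.
  - apply (is_derive_ext (fun x => scal (/2) (v x))).
    intro; unfold scal; simpl; unfold mult; simpl; field.
    apply is_derive_scal. exact Hv.
  - unfold scal; simpl; unfold mult; simpl. field. lra.
Qed.

Lemma is_derive_energy u v t :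
  emden_orbit u v -> is_derive (energy u v) t (- (2 - u t) ^ 2).
Proof.
  intros H. assert (Hz := is_derive_logv u v t H). destruct H as (Hu & Hv & _).
  specialize (Hu t). specialize (Hv t). unfold energy.
  - auto_derive. repeat split; eexists; eauto.
  - rewrite_derive Hu; rewrite_derive Hv; rewrite_derive Hz.
    field.
Qed.

Lemma energy_le u v s t : emden_orbit u v -> s <= t -> energy u v t <= energy u v s.
Proof.
  intros H Hst.
  assert (G := nondecreasing_of_derive (fun x => - energy u v x) (fun x => (2 - u x) ^ 2) s t Hst).
  simpl in G. enough (- energy u v s <= - energy u v t) by lra. apply G.
  - intros x _. evar_last. apply (is_derive_opp (energy u v)), is_derive_energy, H.
    unfold opp; simpl. ring.
  - intros; apply pow2_ge_0.
Qed.

Lemma energy_lt_nbhd u v s : emden_orbit u v -> u s <> 2 ->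
  exists d, 0 < d /\ (forall x, s < x < s + d -> energy u v x < energy u v s) /\
                     (forall x, s - d < x < s -> energy u v s < energy u v x).
Proof.
  intros H Hs.
  assert (Hcont := is_derive_cont u s _ (proj1 H s)).
  destruct (Hcont (Rabs (u s - 2))) as [d [Hd Hd2]]; [apply Rabs_pos_lt; lra|].
  assert (Hne : forall x, Rabs (x - s) < d -> u x <> 2).
  { intros x Hx. destruct (Req_dec s x) as [e|n]; [subst; auto|]. intro e.
    assert (Rabs (u x - u s) < Rabs (u s - 2)).
    { apply (Hd2 x). split; [split; [exact I|auto]|exact Hx]. }
    rewrite e in H0. rewrite Rabs_minus_sym in H0. lra. }
  exists d; split; [auto|]. split; intros x Hx.
  - assert (G := increasing_of_derive (fun y => - energy u v y) (fun y => (2 - u y) ^ 2) s x).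
    simpl in G. enough (- energy u v s < - energy u v x) by lra. apply G; [lra| |].
    + intros y _. evar_last. apply (is_derive_opp (energy u v)), is_derive_energy, H.
      unfold opp; simpl. ring.
    + intros y Hy. assert (u y <> 2) by (apply Hne, Rabs_def1; lra).
      assert (0 < Rsqr (2 - u y)) by (apply Rsqr_pos_lt; lra). unfold Rsqr in *; lra.
  - assert (G := increasing_of_derive (fun y => - energy u v y) (fun y => (2 - u y) ^ 2) x s).
    simpl in G. enough (- energy u v x < - energy u v s) by lra. apply G; [lra| |].
    + intros y _. evar_last. apply (is_derive_opp (energy u v)), is_derive_energy, H.
      unfold opp; simpl. ring.
    + intros y Hy. assert (u y <> 2) by (apply Hne, Rabs_def1; lra).
      assert (0 < Rsqr (2 - u y)) by (apply Rsqr_pos_lt; lra). unfold Rsqr in *; lra.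
Qed.

(** One end off the line u = 2 suffices: the loss is strict near that end, and nothing is gained
    elsewhere. *)
Lemma energy_lt u v s t :
  emden_orbit u v -> s < t -> u s <> 2 \/ u t <> 2 -> energy u v t < energy u v s.
Proof.
  intros H Hst [Hs|Ht].
  - destruct (energy_lt_nbhd u v s H Hs) as [d [Hd [H1 _]]].
    set (x := Rmin t (s + d / 2)).
    assert (s < x <= t /\ x <= s + d/2) by (unfold x, Rmin; destruct (Rle_dec t (s + d/2)); lra).
    assert (energy u v x < energy u v s) by (apply H1; lra).
    assert (energy u v t <= energy u v x) by (apply energy_le; [auto|lra]). lra.
  - destruct (energy_lt_nbhd u v t H Ht) as [d [Hd [_ H1]]].
    set (x := Rmax s (t - d / 2)).
    assert (s <= x < t /\ t - d/2 <= x) by (unfold x, Rmax; destruct (Rle_dec s (t - d/2)); lra).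
    assert (energy u v t < energy u v x) by (apply H1; lra).
    assert (energy u v x <= energy u v s) by (apply energy_le; [auto|lra]). lra.
Qed.

Lemma energy_critical u v t : v t - u t = 0 -> energy u v t = crit_energy (u t).
Proof. intros H. unfold energy, crit_energy, logv. replace (v t) with (u t) by lra. ring. Qed.

Lemma is_derive_crit_energy x : 0 < x -> is_derive crit_energy x ((x - 2) * (1 + 1 / x)).
Proof.
  intros Hx. unfold crit_energy. auto_derive. lra. field. lra.
Qed.

Lemma crit_energy_incr x y : 2 <= x -> x < y -> crit_energy x < crit_energy y.
Proof.
  intros Hx Hy. eapply increasing_of_derive; eauto.
  - intros; apply is_derive_crit_energy; lra.
  - intros z Hz; simpl. apply Rmult_lt_0_compat; [lra|].
    assert (0 < 1 / z) by (apply Rdiv_lt_0_compat; lra). lra.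
Qed.

Lemma crit_energy_decr x y : 0 < x -> x < y -> y <= 2 -> crit_energy y < crit_energy x.
Proof.
  intros Hx Hy H2.
  enough (- crit_energy x < - crit_energy y) by lra.
  apply (increasing_of_derive (fun x => - crit_energy x) (fun x => - ((x - 2) * (1 + 1 / x)))); auto.
  - intros. apply (is_derive_opp crit_energy). apply is_derive_crit_energy; lra.
  - intros z Hz; simpl.
    assert (0 < 1 / z) by (apply Rdiv_lt_0_compat; lra). nra.
Qed.

(* With r = z'/z for z = logv v, the Riccati inequality r' <= - (r^2 + r + 1/2)
   makes atan (2 r + 1) decrease at rate at least 1/2. *)
Lemma logv_zero u v T : emden_orbit u v ->
  (forall t, T <= t <= T + 8 -> -3 < logv v t) ->
  exists t, T <= t <= T + 8 /\ logv v t = 0.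
Proof.
  intros H H3. apply NNPP. intro Hno.
  assert (Hz : forall t, T <= t <= T + 8 -> logv v t <> 0) by (intros t Ht e; apply Hno; eauto).
  set (r := fun t => (2 - u t) / logv v t).
  set (q := fun t => (exp (logv v t) - 1) / logv v t).
  assert (Hd : forall t, T <= t <= T + 8 -> is_derive (fun t => atan (2 * r t + 1)) t
     (2 * (- (r t) ^ 2 - r t - 2 * q t) / (1 + (2 * r t + 1)^2))).
  { intros t Ht. specialize (Hz t Ht).
    assert (Hl := is_derive_logv u v t H). destruct H as (Hu & Hv & Pu & Pv & _).
    specialize (Hu t). specialize (Hv t). specialize (Pv t).
    assert (Hr : is_derive r t (- (r t) ^ 2 - r t - 2 * q t)).
    { unfold r. auto_derive. repeat split; try (eexists; eauto); auto.
      rewrite_derive Hu; rewrite_derive Hl.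
      unfold q. rewrite (exp_logv v t Pv). field. auto. }
    auto_derive. eexists; eauto.
    rewrite_derive Hr. unfold Rsqr; field.
    apply Rgt_not_eq. assert (Q := pow2_ge_0 (2 * r t + 1)). nra. }
  (* Over a window of length 8 the arctangent would fall by at least 4, but its values lie strictly
     within an interval of length pi <= 4. *)
  destruct (mean_value _ _ T (T + 8) ltac:(lra) Hd) as [c [Ic E]].
  assert (Hq : 1/4 <= q c) by (apply exp_slope; [apply Hz|apply H3]; lra).
  assert (B1 := atan_bound (2 * r (T + 8) + 1)).
  assert (B2 := atan_bound (2 * r T + 1)). assert (P4 := PI_4).
  assert (Hle : 2 * (- r c ^ 2 - r c - 2 * q c) / (1 + (2 * r c + 1) ^ 2) <= - (1 / 2)).
  { assert (0 < 1 + (2 * r c + 1)^2) by nra.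
    apply Rmult_le_reg_r with (1 + (2 * r c + 1)^2); auto. unfold Rdiv at 1.
    rewrite Rmult_assoc, Rinv_l by lra. nra. }
  lra.
Qed.

(** * Endless oscillation of u around 2 *)

Lemma orbit_initially_small u v : emden_orbit u v -> exists t0, forall t, t <= t0 -> u t < 1 /\ v t < 1.
Proof. intros H. apply H. lra. Qed.

Lemma logv_neg v t : 0 < v t -> v t < 2 -> logv v t < 0.
Proof. intros H H1. unfold logv. rewrite <- ln_1. apply ln_increasing; lra. Qed.

Lemma logv_cont u v t : emden_orbit u v -> continuity_pt (logv v) t.
Proof. intros H. eapply is_derive_cont, is_derive_logv, H. Qed.

Lemma u_cont u v t : emden_orbit u v -> continuity_pt u t.
Proof. intros H. exact (is_derive_cont u t _ (proj1 H t)). Qed.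

(* e^t (2 - u t) is nondecreasing as long as logv v <= 0. *)
Lemma logv_slope_pos u v s t : emden_orbit u v -> s <= t -> u s < 2 ->
  (forall x, s < x < t -> logv v x < 0) -> u t < 2.
Proof.
  intros H Hst Hs Hneg.
  assert (G : exp s * (2 - u s) <= exp t * (2 - u t)).
  { apply (nondecreasing_of_derive (fun x => exp x * (2 - u x)) (fun x => exp x * (2 - v x))); auto.
    - intros x _. destruct H as (Hu & _). specialize (Hu x).
      auto_derive. eexists; eauto. rewrite_derive Hu. ring.
    - intros x Hx. specialize (Hneg x Hx). destruct H as (_ & _ & _ & Pv & _).
      rewrite (exp_logv v x (Pv x)).
      assert (exp (logv v x) < exp 0) by (apply exp_increasing; auto).
      rewrite exp_0 in *. assert (P := exp_pos x). nra. }
  assert (Ps := exp_pos s). assert (Pt := exp_pos t).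
  destruct (Rlt_le_dec (u t) 2); auto. nra.
Qed.

Lemma logv_reaches_zero u v t0 : emden_orbit u v -> u t0 < 2 ->
  exists t, t0 <= t /\ 0 <= logv v t.
Proof.
  intros H Hu0. apply NNPP. intro Hno.
  assert (Hneg : forall t, t0 <= t -> logv v t < 0).
  { intros t Ht. destruct (Rlt_le_dec (logv v t) 0); auto. exfalso; eauto. }
  destruct (classic (exists T, t0 <= T /\ -3 < logv v T)) as [[T [HT H3]]|Hlow].
  - destruct (logv_zero u v T H) as [t [It Et]].
    + intros t Ht. apply Rlt_le_trans with (logv v T); auto.
      apply (nondecreasing_of_derive (logv v) (fun t => 2 - u t)); [lra| |].
      * intros; apply is_derive_logv, H.
      * intros x Hx. enough (u x < 2) by lra. apply (logv_slope_pos u v t0 x H); auto; [lra|].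
        intros; apply Hneg; lra.
    + assert (N := Hneg t). lra.
  (* While z <= -3, v = 2 e^z <= 1/2, so 2 - u + z - t is nondecreasing; as u > 0, this forces z to
     grow at least linearly. *)
  - assert (H3 : forall t, t0 <= t -> logv v t <= -3).
    { intros t Ht. destruct (Rle_lt_dec (logv v t) (-3)); auto. exfalso; eauto. }
    assert (G : forall t, t0 <= t -> 2 - u t0 + logv v t0 - t0 <= 2 - u t + logv v t - t).
    { intros t Ht.
      apply (nondecreasing_of_derive (fun x => 2 - u x + logv v x - x) (fun x => 1 - v x)); auto.
      - intros x _. assert (Hz := is_derive_logv u v x H). destruct H as (Hu & _). specialize (Hu x).
        auto_derive. repeat split; eexists; eauto.
        rewrite_derive Hu; rewrite_derive Hz. ring.
      - intros x Hx. destruct H as (_ & _ & _ & Pv & _). rewrite (exp_logv v x (Pv x)).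
        assert (E : exp (logv v x) <= exp (-3)).
        { assert (L := H3 x ltac:(lra)). destruct (Req_dec (logv v x) (-3)) as [->|n]; [lra|].
          left; apply exp_increasing; lra. }
        assert (C := exp_le_chord (-3)). lra. }
    (* At this time the bound [G] reads z >= 2 + u. *)
    set (t := t0 + 2 + u t0 - logv v t0).
    assert (Pu := proj1 (proj2 (proj2 H))). assert (P0 := Pu t0). assert (Pt := Pu t).
    assert (N0 := Hneg t0 ltac:(lra)).
    assert (Ht : t0 <= t) by (unfold t; lra).
    assert (G1 := G t Ht). assert (G3 := H3 t Ht). unfold t in *. lra.
Qed.

(** The bound on z is the range of the Riccati estimate; positive energy keeps the orbit off the
    equilibrium u = v = 2. At the first zero of z, 0 < u < 2 makes the energy less than 2, which
    confines z from then on. Positivity persists because the energy E satisfies E' = -z'^2 >= -2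
    E. *)
Lemma energy_eventually u v : emden_orbit u v ->
  exists T, forall t, T <= t -> -3 < logv v t /\ 0 < energy u v t.
Proof.
  intros H. destruct (orbit_initially_small u v H) as [t0 Ht0].
  assert (S0 := Ht0 t0 ltac:(lra)).
  assert (Pu := proj1 (proj2 (proj2 H))). assert (Pv := proj1 (proj2 (proj2 (proj2 H)))).
  assert (Z0 : logv v t0 < 0) by (apply logv_neg; [auto|lra]).
  destruct (logv_reaches_zero u v t0 H) as [t1 [I1 Z1]]; [lra|].
  destruct (first_crossing (logv v) t0 t1 0) as [c [Ic [Ec Hc]]]; auto.
  { intro; eapply logv_cont; eauto. }
  assert (Uc : u c < 2) by (apply (logv_slope_pos u v t0 c H); [lra|lra|intros; apply Hc; lra]).
  exists c. intros t Ht. split.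
  - assert (El := energy_le u v c t H Ht).
    assert (Ec2 : energy u v c < 2).
    { unfold energy. rewrite (exp_logv v c (Pv c)), Ec, exp_0. specialize (Pu c). nra. }
    unfold energy in El at 1. specialize (Pv t). nra.
  - assert (G : energy u v t0 * exp (2 * t0) <= energy u v t * exp (2 * t)).
    { apply (nondecreasing_of_derive (fun x => energy u v x * exp (2 * x))
        (fun x => exp (2 * x) * (2 * energy u v x - (2 - u x)^2))); [lra| |].
      - intros x _. assert (He := is_derive_energy u v x H).
        auto_derive. repeat split; eexists; eauto.
        rewrite_derive He. simpl. ring.
      - intros x Hx. apply Rmult_le_pos; [left; apply exp_pos|].
        unfold energy. assert (L := ln_le_sub1 (v x / 2) ltac:(specialize (Pv x); lra)).
        fold (logv v x) in L. lra. }
    assert (0 < energy u v t0).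
    { unfold energy. assert (L := ln_lt_sub1 (v t0 / 2) ltac:(specialize (Pv t0); lra)).
      fold (logv v t0) in L. specialize (L ltac:(lra)). nra. }
    assert (P0 := exp_pos (2 * t0)). assert (P1 := exp_pos (2 * t)).
    assert (0 < energy u v t0 * exp (2 * t0)) by (apply Rmult_lt_0_compat; auto).
    destruct (Rlt_le_dec 0 (energy u v t)); auto. nra.
Qed.

Lemma oscillation u v T : emden_orbit u v ->
  (exists t, T < t /\ 2 < u t) /\ (exists t, T < t /\ u t < 2).
Proof.
  intros H. destruct (energy_eventually u v H) as [T0 HT0].
  set (T1 := Rmax T T0 + 1).
  assert (HT1 : T < T1 /\ T0 < T1).
  { unfold T1. assert (L := Rmax_l T T0). assert (R := Rmax_r T T0). lra. }
  destruct (logv_zero u v T1 H) as [p [Ip Ep]].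
  { intros t Ht; apply HT0; lra. }
  (* The second window starts beyond the end T1 + 8 of the first, so p < q. *)
  destruct (logv_zero u v (T1 + 9) H) as [q [Iq Eq]].
  { intros t Ht; apply HT0; lra. }
  destruct (mean_value (logv v) (fun t => 2 - u t) p q) as [m [Im Em]]; [lra| |].
  { intros; apply is_derive_logv, H. }
  assert (Hm : u m = 2) by (rewrite Ep, Eq in Em; nra).
  (* u = 2 together with z = 0 would mean zero energy. With z nonzero at m, the mean slopes of z
     over [p,m] and [m,q] have opposite signs. *)
  assert (Zm : logv v m <> 0).
  { intro e. destruct (HT0 m) as [_ P]; [lra|].
    unfold energy in P. rewrite (exp_logv v m) in P by apply H. rewrite e, Hm, exp_0 in P. lra. }
  destruct (mean_value (logv v) (fun t => 2 - u t) p m) as [a [Ia Ea]]; [lra| |].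
  { intros; apply is_derive_logv, H. }
  destruct (mean_value (logv v) (fun t => 2 - u t) m q) as [b [Ib Eb]]; [lra| |].
  { intros; apply is_derive_logv, H. }
  rewrite Ep in Ea. rewrite Eq in Eb.
  destruct (Rlt_le_dec (logv v m) 0) as [h|h].
  - split; [exists a|exists b]; split; try lra; nra.
  - split; [exists b|exists a]; split; try lra; nra.
Qed.

(** Each induction step splits off one passage of u from above 2 to below 2 and looks for the others
    after it. [delta] is the least of finitely many gaps, so it can be chosen before N. *)
Lemma many_crossings u v (K : nat) : emden_orbit u v -> forall T,
  exists delta, 0 < delta /\ forall N, Rabs (N - 2) < delta ->
    exists ts : nat -> R,
      (forall i, (i < K)%nat -> T < ts i /\ u (ts i) = N) /\
      (forall i j, (i < j < K)%nat -> ts i < ts j).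
Proof.
  intros H. induction K as [|K IH]; intros T.
  - exists 1; split; [lra|]. intros N _. exists (fun _ => 0). split; intros; lia.
  - destruct (oscillation u v T H) as [[a [Ia Ua]] _].
    destruct (oscillation u v a H) as [_ [b [Ib Ub]]].
    destruct (IH b) as [d [Hd HK]].
    exists (Rmin d (Rmin (u a - 2) (2 - u b))). split.
    { repeat apply Rmin_pos; lra. }
    intros N HN.
    assert (L1 := Rmin_l d (Rmin (u a - 2) (2 - u b))).
    assert (L2 := Rmin_r d (Rmin (u a - 2) (2 - u b))).
    assert (L3 := Rmin_l (u a - 2) (2 - u b)).
    assert (L4 := Rmin_r (u a - 2) (2 - u b)).
    destruct (HK N) as [ts [H1 H2]]; [lra|].
    apply Rabs_def2 in HN.
    destruct (ivt_value u a b N) as [c [Ic Ec]]; [lra| |nra|].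
    { intro; eapply u_cont; eauto. }
    exists (fun i => match i with O => c | S i => ts i end). split.
    + intros [|i] Hi; [split; [lra|auto]|].
      destruct (H1 i) as [P Q]; [lia|]. split; [lra|auto].
    + intros [|i] [|j] Hij; try lia.
      * destruct (H1 j) as [P _]; [lia|]. lra.
      * apply H2; lia.
Qed.

(** * The first maximum and the first minimum of u *)

Lemma initial_increase u v a : emden_orbit u v -> (forall t, t < a -> u t < 2) ->
  forall t, t <= a -> 0 < v t - u t.
Proof.
  intros H Ha t Ht.
  destruct (Rlt_le_dec 0 (v t - u t)) as [|Hneg]; auto. exfalso.
  assert (Pu := proj1 (proj2 (proj2 H))). assert (Pv := proj1 (proj2 (proj2 (proj2 H)))).
  (* Since u' = v - u, (e^t u')' = e^t v (2 - u) > 0 while u < 2. *)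
  assert (Hinc : forall x y, x < y -> y <= a -> exp x * (v x - u x) < exp y * (v y - u y)).
  { intros x y Hxy Hy.
    apply (increasing_of_derive (fun x => exp x * (v x - u x)) (fun x => exp x * (v x * (2 - u x)))); auto.
    - intros z _. destruct H as (Hu & Hv & _). specialize (Hu z). specialize (Hv z).
      auto_derive. repeat split; eexists; eauto.
      rewrite_derive Hu; rewrite_derive Hv. ring.
    - intros z Hz. apply Rmult_lt_0_compat; [apply exp_pos|].
      apply Rmult_lt_0_compat; auto. specialize (Ha z). lra. }
  (* One unit before t the quantity is strictly negative, and further back it stays below -k; but
     near -oo it exceeds -u, hence -k. *)
  set (k := - (exp (t - 1) * (v (t - 1) - u (t - 1)))).
  assert (Hk : 0 < k).
  { assert (L := Hinc (t - 1) t). assert (P := exp_pos t). unfold k. nra. }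
  destruct (proj2 (proj2 (proj2 (proj2 H))) k Hk) as [T HT].
  set (x := Rmin T (Rmin (t - 2) 0)).
  assert (Hx : x <= T /\ x <= t - 2 /\ x <= 0).
  { unfold x. assert (L1 := Rmin_l T (Rmin (t - 2) 0)). assert (L2 := Rmin_r T (Rmin (t - 2) 0)).
    assert (L3 := Rmin_l (t - 2) 0). assert (L4 := Rmin_r (t - 2) 0). lra. }
  assert (L := Hinc x (t - 1) ltac:(lra) ltac:(lra)).
  destruct (HT x) as [Ux _]; [lra|].
  assert (Ex : exp x <= 1).
  { rewrite <- exp_0. destruct (Req_dec x 0) as [->|n]; [lra|left; apply exp_increasing; lra]. }
  assert (Px := exp_pos x). specialize (Pu x). specialize (Pv x).
  unfold k in Ux. nra.
Qed.

(** [a] is the first time with u = 2, [t1] maximizes u on [a,b] and [t2] minimizes u on [t1,c],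
    where b is any later time with u < 2 and c any time after b with u > 2. A competing value
    elsewhere would produce a second critical point on the same side of 2, against the energy
    comparison. *)
Lemma orbit_shape u v : emden_orbit u v ->
  exists a t1 t2 : R, t1 < t2 /\ u t2 < 2 < u t1 /\
    (forall t, t <> t1 -> u t < u t1) /\
    (forall t, a <= t -> u t2 <= u t) /\
    (forall s t, s < t -> t <= a -> u s < u t).
Proof.
  intros H. assert (Hd := proj1 H).
  assert (Pu := proj1 (proj2 (proj2 H))).
  assert (Hcont : forall x, continuity_pt u x) by (intro; eapply u_cont; eauto).
  destruct (orbit_initially_small u v H) as [t0 Ht0].
  destruct (oscillation u v t0 H) as [[q [Iq Uq]] _].
  destruct (first_crossing u t0 q 2) as [a [Ia [Ua Hbefore]]]; auto; try lra.
  { specialize (Ht0 t0); lra. }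
  assert (Ha : forall t, t < a -> u t < 2).
  { intros t Ht. destruct (Rle_lt_dec t t0) as [h|h]; [specialize (Ht0 t); lra|]. apply Hbefore; lra. }
  assert (HD := initial_increase u v a H Ha).
  (* u' > 0 at a, so u exceeds 2 at times arbitrarily close after a. *)
  assert (Hexit : forall b, a < b -> exists c, a < c < b /\ 2 < u c).
  { intros b Hb. destruct (proj1 (is_derive_Reals _ _ _) (Hd a) (v a - u a)) as [d Hdd].
    apply HD; lra.
    set (h := Rmin (d / 2) ((b - a) / 2)).
    assert (Pd := cond_pos d).
    assert (L1 := Rmin_l (d / 2) ((b - a) / 2)). assert (L2 := Rmin_r (d / 2) ((b - a) / 2)).
    fold h in L1, L2.
    assert (Ph : 0 < h) by (apply Rmin_pos; lra).
    specialize (Hdd h). assert (Rabs ((u (a + h) - u a) / h - (v a - u a)) < v a - u a).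
    { apply Hdd; [lra|]. rewrite Rabs_pos_eq; lra. }
    apply Rabs_def2 in H0. exists (a + h). split; [lra|].
    assert (Hq : 0 < (u (a + h) - u a) / h) by lra.
    apply (Rmult_lt_compat_r h) in Hq; auto. unfold Rdiv in Hq.
    rewrite Rmult_assoc, Rinv_l in Hq by lra. lra. }
  destruct (oscillation u v a H) as [_ [b [Ib Ub]]].
  assert (Hmax : forall p q c, p < q -> u p <= 2 -> u q <= 2 -> p <= c <= q -> 2 < u c ->
     exists m, p < m < q /\ u c <= u m /\ v m - u m = 0 /\ forall x, p <= x <= q -> u x <= u m).
  { intros p q' c Hpq Hp Hq Hc Huc. apply (interior_max u (fun t => v t - u t)); auto; try lra.
    exists c. split; [auto|lra]. }
  destruct (Hexit b Ib) as [c0 [Ic0 Uc0]].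
  destruct (Hmax a b c0) as [t1 [I1 [U1 [V1 M1]]]]; try lra.
  assert (Hlater : forall s t, s < t -> 2 < u s -> 2 < u t -> v s - u s = 0 -> v t - u t = 0 -> u t < u s).
  { intros s t Hst Us Ut Vs Vt.
    assert (L := energy_lt u v s t H Hst ltac:(left; lra)).
    rewrite !energy_critical in L by auto.
    destruct (Rlt_le_dec (u t) (u s)) as [|h]; auto.
    destruct (Req_dec (u s) (u t)) as [e|n]; [rewrite e in L; lra|].
    assert (G := crit_energy_incr (u s) (u t)). lra. }
  assert (Hlater' : forall s t, s < t -> u s < 2 -> u t < 2 -> v s - u s = 0 -> v t - u t = 0 -> u s < u t).
  { intros s t Hst Us Ut Vs Vt.
    assert (L := energy_lt u v s t H Hst ltac:(left; lra)).
    rewrite !energy_critical in L by auto.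
    destruct (Rlt_le_dec (u s) (u t)) as [|h]; auto.
    destruct (Req_dec (u s) (u t)) as [e|n]; [rewrite e in L; lra|].
    assert (G := crit_energy_decr (u t) (u s)). specialize (Pu t). lra. }
  (* A dip below 2 before t1 would follow a critical maximum that, being earlier, exceeds [u t1]. *)
  assert (Habove : forall t, a <= t <= t1 -> 2 <= u t).
  { intros t Ht. destruct (Rle_lt_dec 2 (u t)) as [|h]; auto. exfalso.
    destruct (Req_dec a t) as [e|n]; [subst; lra|].
    destruct (Req_dec t t1) as [e|n1]; [subst; lra|].
    destruct (Hexit t) as [c [Ic Uc]]; [lra|].
    destruct (Hmax a t c) as [m [Im [Um [Vm _]]]]; try lra.
    assert (L := Hlater m t1). assert (L2 := M1 m). lra. }
  assert (Hglob : forall t, t <> t1 -> u t < u t1).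
  { intros t Ht. destruct (Rlt_le_dec (u t) (u t1)) as [|h]; auto. exfalso.
    assert (Ia' : a < t).
    { destruct (Rlt_le_dec a t) as [|g]; auto. destruct (Req_dec a t) as [e|n]; [subst; lra|].
      specialize (Ha t). lra. }
    destruct (Rle_lt_dec t b) as [g|g].
    - assert (Et : u t = u t1) by (specialize (M1 t); lra).
      assert (t < b). { destruct (Req_dec t b) as [e|n]; [subst; lra|lra]. }
      assert (Vt : v t - u t = 0).
      { assert (pr : derivable_pt_lim u t (v t - u t)) by (apply is_derive_Reals; auto).
        assert (E := deriv_maximum u a b t (exist _ _ pr)). simpl in E. apply E; auto.
        intros x X1 X2. rewrite Et. apply M1. lra. }
      destruct (Rtotal_order t t1) as [o|[o|o]]; [| auto |].
      + assert (L := Hlater t t1). lra.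
      + assert (L := Hlater t1 t). lra.
    - destruct (oscillation u v t H) as [_ [e [Ie Ue]]].
      destruct (Hmax b e t) as [m [Im [Um [Vm _]]]]; try lra.
      assert (L := Hlater t1 m). lra. }
  destruct (oscillation u v b H) as [[c [Ic Uc]] _].
  destruct (interior_min u (fun t => v t - u t) t1 c (u b)) as [t2 [I2 [U2 [V2 M2]]]]; auto; try lra.
  { exists b; lra. }
  exists a, t1, t2. split; [lra|]. split; [lra|]. split; [auto|]. split.
  - intros t Ht. destruct (Rle_lt_dec t t1) as [g|g]; [specialize (Habove t); lra|].
    destruct (Rle_lt_dec t c) as [g'|g']; [apply M2; lra|].
    destruct (Rle_lt_dec (u t2) (u t)) as [|h]; auto. exfalso.
    destruct (oscillation u v t H) as [[e [Ie Ue]] _].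
    destruct (interior_min u (fun t => v t - u t) c e (u t)) as [m [Im [Um [Vm _]]]]; auto; try lra.
    { exists t; lra. }
    assert (L := Hlater' t2 m). lra.
  - intros s t Hst Ht. apply (increasing_of_derive u (fun t => v t - u t)); auto.
    intros x Hx. apply HD. lra.
Qed.

(** * The regular solution *)

Definition mom (k : nat) (h : R -> R) (r : R) : R :=
  RInt (fun x => x ^ k * exp (h x)) 0 r.

(* The equation with w(0) = w'(0) = 0 is the fixed point problem w = picard w,
   whose integrand is x (1 - x/r) e^(w x). At r = 0 the value is 0. *)
Definition picard (h : R -> R) (r : R) : R := - (mom 1 h r - mom 2 h r / r).

(** On nonpositive values [exp] is bounded by 1 and 1-Lipschitz, so the contraction works on the
    whole half-line. Continuity on all of R makes the moments two-sidedly differentiable, at 0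
    too. *)
Definition nonpos_cont (h : R -> R) : Prop :=
  (forall x, continuity_pt h x) /\ (forall x, h x <= 0).

Lemma exp_le_1 (x : R) : x <= 0 -> exp x <= 1.
Proof.
  intros H. rewrite <- exp_0. destruct (Req_dec x 0) as [->|n]; [lra|left; apply exp_increasing; lra].
Qed.

Lemma mom_0 k h : mom k h 0 = 0.
Proof. exact (RInt_point 0 (fun x => x ^ k * exp (h x))). Qed.

Lemma is_derive_mom k h r : nonpos_cont h -> is_derive (mom k h) r (r ^ k * exp (h r)).
Proof.
  intros [Hc _].
  assert (C : forall x, continuous (fun x => x ^ k * exp (h x)) x).
  { intro x. apply continuity_pt_filterlim. apply continuity_pt_mult.
    - apply derivable_continuous_pt, derivable_pt_pow.
    - apply (continuity_pt_comp h exp); auto.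
      apply derivable_continuous_pt, derivable_pt_exp. }
  apply (is_derive_RInt (fun x => x ^ k * exp (h x)) (mom k h) 0 r).
  - apply filter_forall. intro x. apply (@RInt_correct R_CompleteNormedModule).
    apply (ex_RInt_continuous (V := R_CompleteNormedModule)). intros; apply C.
  - apply C.
Qed.

Lemma mom_bound k h r : nonpos_cont h -> Rabs (mom k h r) <= Rabs r ^ (S k).
Proof.
  intros H.
  destruct (MVT_gen (mom k h) 0 r (fun x => x ^ k * exp (h x))) as [c [Ic E]].
  - intros; apply is_derive_mom, H.
  - intros; eapply is_derive_cont, is_derive_mom, H.
  - rewrite mom_0 in E. replace (mom k h r) with (c ^ k * exp (h c) * r) by lra.
    rewrite !Rabs_mult, <- RPow_abs. simpl. rewrite Rmult_comm.
    apply Rmult_le_compat_l; [apply Rabs_pos|].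
    rewrite <- (Rmult_1_r (Rabs r ^ k)).
    apply Rmult_le_compat; try apply Rabs_pos; [apply pow_le, Rabs_pos| |].
    + apply pow_incr. split; [apply Rabs_pos|].
      unfold Rmin, Rmax in Ic. destruct (Rle_dec 0 r); split_Rabs; lra.
    + rewrite Rabs_pos_eq by (left; apply exp_pos). apply exp_le_1, H.
Qed.

Lemma mom_pos k h r : nonpos_cont h -> 0 < r -> 0 < mom k h r.
Proof.
  intros H Hr. rewrite <- (mom_0 k h).
  apply (increasing_of_derive (mom k h) (fun x => x ^ k * exp (h x))); auto.
  - intros; apply is_derive_mom, H.
  - intros. apply Rmult_lt_0_compat; [apply pow_lt; lra|apply exp_pos].
Qed.

Lemma picard_0 h : picard h 0 = 0.
Proof. unfold picard. rewrite !mom_0. unfold Rdiv. ring. Qed.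

Lemma picard_bound h r : nonpos_cont h -> Rabs (picard h r) <= 2 * r ^ 2.
Proof.
  intros H. assert (B1 := mom_bound 1 h r H). assert (B2 := mom_bound 2 h r H).
  destruct (Req_dec r 0) as [->|n]; [rewrite picard_0, Rabs_R0; lra|].
  unfold picard. rewrite Rabs_Ropp. unfold Rminus.
  eapply Rle_trans; [apply Rabs_triang|]. rewrite Rabs_Ropp, Rabs_div by auto.
  assert (P : 0 < Rabs r) by (apply Rabs_pos_lt; auto).
  assert (Rabs (mom 2 h r) / Rabs r <= Rabs r ^ 2).
  { apply Rmult_le_reg_r with (Rabs r); auto. unfold Rdiv.
    rewrite Rmult_assoc, Rinv_l by lra. simpl in *. lra. }
  rewrite <- (pow2_abs r). lra.
Qed.

(** The first integral of (r^2 w')' = - r^2 e^w; the boundary terms in the derivative of [picard]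
    cancel. *)
Definition picard' (h : R -> R) (r : R) : R := - (mom 2 h r / r ^ 2).

Lemma picard'_bound h r : nonpos_cont h -> Rabs (picard' h r) <= Rabs r.
Proof.
  intros H. assert (B2 := mom_bound 2 h r H). unfold picard'. rewrite Rabs_Ropp.
  destruct (Req_dec r 0) as [->|n].
  { rewrite mom_0. unfold Rdiv. rewrite Rmult_0_l. lra. }
  assert (P : 0 < Rabs r) by (apply Rabs_pos_lt; auto).
  rewrite Rabs_div by (apply pow_nonzero; auto). rewrite <- RPow_abs.
  assert (P2 : 0 < Rabs r ^ 2) by (apply pow_lt; auto).
  apply Rmult_le_reg_r with (Rabs r ^ 2); auto. unfold Rdiv.
  rewrite Rmult_assoc, Rinv_l by lra. simpl in *. lra.
Qed.

Lemma is_derive_picard h r : nonpos_cont h -> is_derive (picard h) r (picard' h r).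
Proof.
  intros H. destruct (Req_dec r 0) as [->|n].
  - apply is_derive_Reals. intros eps He.
    exists (mkposreal (eps / 2) ltac:(lra)). simpl. intros k Hk Hk2.
    rewrite Rplus_0_l, picard_0. unfold picard'. rewrite mom_0.
    apply Rle_lt_trans with (Rabs (picard h k / k)); [right; f_equal; unfold Rdiv; ring|].
    rewrite Rabs_div by auto. assert (P : 0 < Rabs k) by (apply Rabs_pos_lt; auto).
    apply Rmult_lt_reg_r with (Rabs k); auto. unfold Rdiv.
    rewrite Rmult_assoc, Rinv_l by lra.
    assert (B := picard_bound h k H). rewrite <- (pow2_abs k) in B. nra.
  - assert (D1 := is_derive_mom 1 h r H). assert (D2 := is_derive_mom 2 h r H).
    unfold picard, picard'. auto_derive.
    + repeat split; auto; eexists; eauto.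
    + rewrite_derive D1; rewrite_derive D2. field. auto.
Qed.

Lemma picard'_cont h r : nonpos_cont h -> continuity_pt (picard' h) r.
Proof.
  intros H. destruct (Req_dec r 0) as [->|n].
  - intros eps He. exists eps. split; [auto|]. intros x [_ Hx]. simpl in *. unfold Rdist in *.
    replace (picard' h 0) with 0.
    2: { unfold picard'. rewrite mom_0. unfold Rdiv. ring. }
    rewrite Rminus_0_r in *. assert (B := picard'_bound h x H). lra.
  - unfold picard'. apply continuity_pt_opp, continuity_pt_div.
    + eapply is_derive_cont, is_derive_mom, H.
    + apply derivable_continuous_pt, derivable_pt_pow.
    + apply pow_nonzero; auto.
Qed.

Lemma is_derive_picard' h r : nonpos_cont h -> r <> 0 ->
  is_derive (picard' h) r (- (2 / r * picard' h r) - exp (h r)).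
Proof.
  intros H n. assert (D2 := is_derive_mom 2 h r H).
  unfold picard'. auto_derive.
  - repeat split; [eexists; eauto|]. apply Rmult_integral_contrapositive_currified; lra.
  - rewrite_derive D2. field. auto.
Qed.

Lemma picard_nonpos h r : nonpos_cont h -> 0 <= r -> picard h r <= 0.
Proof.
  intros H Hr. enough (- picard h 0 <= - picard h r) by (rewrite picard_0 in *; lra).
  apply (nondecreasing_of_derive (fun x => - picard h x) (fun x => - picard' h x)); auto.
  - intros. apply (is_derive_opp (picard h)), is_derive_picard, H.
  - intros x Hx. unfold picard'. assert (P := mom_pos 2 h x H ltac:(lra)).
    assert (0 < x ^ 2) by (apply pow_lt; lra).
    assert (0 < mom 2 h x / x ^ 2) by (apply Rdiv_lt_0_compat; auto). lra.
Qed.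

(** * Contraction and Picard iteration *)

Lemma exp_lipschitz (M a b : R) : a <= M -> b <= M -> Rabs (exp a - exp b) <= exp M * Rabs (a - b).
Proof.
  assert (G : forall a b, a <= b -> b <= M -> Rabs (exp a - exp b) <= exp M * Rabs (a - b)).
  { intros a' b' Hab Hb.
    assert (E : exp a' = exp b' * exp (a' - b')) by (rewrite <- exp_plus; f_equal; ring).
    assert (L := exp_ineq1_le (a' - b')). assert (Pb := exp_pos b').
    assert (Eb : exp b' <= exp M).
    { destruct (Req_dec b' M) as [->|n]; [lra|left; apply exp_increasing; lra]. }
    assert (exp (a' - b') <= 1) by (apply exp_le_1; lra).
    rewrite !Rabs_left1; [| lra | nra]. nra. }
  intros Ha Hb. destruct (Rle_lt_dec a b); [apply G; auto|].
  rewrite Rabs_minus_sym, (Rabs_minus_sym a b). apply G; lra.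
Qed.

(* The weight e^(x^2) makes picard a contraction of ratio 1/2, since
   (e^(x^2))' = 2 x e^(x^2) dominates twice the kernel. *)
Lemma picard_contraction h k c r : nonpos_cont h -> nonpos_cont k -> 0 <= r ->
  (forall x, Rabs (h x - k x) <= c * exp (x ^ 2)) ->
  Rabs (picard h r - picard k r) <= c / 2 * exp (r ^ 2).
Proof.
  intros Hh Hk Hr Hb.
  assert (Hc : 0 <= c).
  { specialize (Hb 0). assert (A := Rabs_pos (h 0 - k 0)). assert (P := exp_pos (0 ^ 2)). nra. }
  destruct (Req_dec r 0) as [->|n].
  { rewrite !picard_0, Rminus_0_r, Rabs_R0. assert (P := exp_pos (0 ^ 2)). nra. }
  (* The r in the kernel is frozen, so that [phi'] is the integrand of the difference and [phi r]
     its full integral. *)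
  set (phi := fun x => (mom 1 h x - mom 2 h x / r) - (mom 1 k x - mom 2 k x / r)).
  set (phi' := fun x => x * (1 - x / r) * (exp (h x) - exp (k x))).
  assert (Dphi : forall x, is_derive phi x (phi' x)).
  { intro x. assert (D1 := is_derive_mom 1 h x Hh). assert (D2 := is_derive_mom 2 h x Hh).
    assert (D3 := is_derive_mom 1 k x Hk). assert (D4 := is_derive_mom 2 k x Hk).
    unfold phi, phi'. auto_derive.
    - repeat split; auto; eexists; eauto.
    - rewrite_derive D1; rewrite_derive D2; rewrite_derive D3; rewrite_derive D4. field. auto. }
  assert (Dg : forall x, is_derive (fun x => c / 2 * exp (x ^ 2)) x (c * x * exp (x ^ 2))).
  { intro x. auto_derive; auto. simpl. field. }
  assert (Bphi : forall x, 0 < x < r -> Rabs (phi' x) <= c * x * exp (x ^ 2)).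
  { intros x Hx. unfold phi'. rewrite !Rabs_mult.
    assert (L := exp_lipschitz 0 (h x) (k x) (proj2 Hh x) (proj2 Hk x)). rewrite exp_0 in L.
    specialize (Hb x).
    assert (0 < x / r < 1).
    { split; [apply Rdiv_lt_0_compat; lra|]. apply Rmult_lt_reg_r with r; [lra|].
      unfold Rdiv. rewrite Rmult_assoc, Rinv_l by lra. lra. }
    rewrite (Rabs_pos_eq x), (Rabs_pos_eq (1 - x / r)) by lra.
    assert (A := Rabs_pos (exp (h x) - exp (k x))).
    apply Rle_trans with (x * 1 * (c * exp (x ^ 2))); [|lra].
    apply Rmult_le_compat; try lra; nra. }
  assert (Hphi0 : phi 0 = 0) by (unfold phi; rewrite !mom_0; unfold Rdiv; ring).
  assert (Up : c / 2 * exp (0 ^ 2) - phi 0 <= c / 2 * exp (r ^ 2) - phi r).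
  { apply (nondecreasing_of_derive (fun x => c / 2 * exp (x ^ 2) - phi x)
             (fun x => c * x * exp (x ^ 2) - phi' x)); auto.
    - intros x _. apply (is_derive_minus (fun x => c / 2 * exp (x ^ 2)) phi); auto.
    - intros x Hx. specialize (Bphi x Hx). apply Rabs_le_between in Bphi. lra. }
  assert (Lo : c / 2 * exp (0 ^ 2) + phi 0 <= c / 2 * exp (r ^ 2) + phi r).
  { apply (nondecreasing_of_derive (fun x => c / 2 * exp (x ^ 2) + phi x)
             (fun x => c * x * exp (x ^ 2) + phi' x)); auto.
    - intros x _. apply (is_derive_plus (fun x => c / 2 * exp (x ^ 2)) phi); auto.
    - intros x Hx. specialize (Bphi x Hx). apply Rabs_le_between in Bphi. lra. }
  replace (picard h r - picard k r) with (- phi r) by (unfold picard, phi; ring).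
  rewrite Hphi0 in *. assert (P := exp_pos (0 ^ 2)).
  rewrite Rabs_Ropp. apply Rabs_le_between. split; nra.
Qed.

(** The even reflection keeps the iterates in [nonpos_cont], although the sign and contraction
    estimates are for r >= 0 only. *)
Fixpoint iterate (n : nat) (s : R) : R :=
  match n with O => 0 | S n => picard (iterate n) (Rabs s) end.

Lemma iterate_nonpos_cont n : nonpos_cont (iterate n).
Proof.
  induction n as [|n IH]; split; intro x; simpl.
  - apply continuity_pt_const. intros p q; reflexivity.
  - lra.
  - apply (continuity_pt_comp Rabs (picard (iterate n))); [apply Rcontinuity_abs|].
    eapply is_derive_cont, is_derive_picard, IH.
  - apply picard_nonpos; [auto|apply Rabs_pos].
Qed.

Lemma iterate_step n s : Rabs (iterate (S n) s - iterate n s) <= 2 * (1 / 2) ^ n * exp (s ^ 2).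
Proof.
  revert s. induction n as [|n IH]; intro s.
  - simpl iterate. rewrite Rminus_0_r.
    assert (B := picard_bound (iterate 0) (Rabs s) (iterate_nonpos_cont 0)).
    rewrite pow2_abs in B. assert (E := exp_ineq1_le (s ^ 2)). simpl in *. lra.
  - change (Rabs (picard (iterate (S n)) (Rabs s) - picard (iterate n) (Rabs s))
      <= 2 * (1 / 2) ^ S n * exp (s ^ 2)).
    replace (2 * (1 / 2) ^ S n) with (2 * (1 / 2) ^ n / 2) by (simpl; field).
    rewrite <- (pow2_abs s). apply picard_contraction; auto using iterate_nonpos_cont, Rabs_pos.
Qed.

Lemma iterate_cauchy n k s :
  Rabs (iterate (k + n) s - iterate n s) <= 4 * (1 / 2) ^ n * exp (s ^ 2).
Proof.
  assert (P := exp_pos (s ^ 2)).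
  (* The exact partial geometric sum is what the induction on k reproduces. *)
  enough (Rabs (iterate (k + n) s - iterate n s) <=
          4 * (1 / 2) ^ n * (1 - (1 / 2) ^ k) * exp (s ^ 2)).
  { eapply Rle_trans; [exact H|].
    assert (0 < (1/2)^n) by (apply pow_lt; lra). assert (0 < (1/2)^k) by (apply pow_lt; lra).
    assert (0 < (1/2)^n * (1/2)^k * exp (s^2)) by (repeat apply Rmult_lt_0_compat; auto). nra. }
  induction k as [|k IH].
  - simpl. rewrite Rminus_diag, Rabs_R0. lra.
  - replace (iterate (S k + n) s - iterate n s) with
      ((iterate (S (k + n)) s - iterate (k + n) s) + (iterate (k + n) s - iterate n s)) by (simpl; ring).
    eapply Rle_trans; [apply Rabs_triang|].
    assert (St := iterate_step (k + n) s). rewrite pow_add in St.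
    rewrite <- (tech_pow_Rmult (1 / 2) k). lra.
Qed.

Lemma half_pow_small (M eps : R) : 0 < eps -> exists n0, forall n, (n0 <= n)%nat -> M * (1 / 2) ^ n < eps.
Proof.
  intros He.
  destruct (pow_lt_1_zero (1 / 2) ltac:(rewrite Rabs_pos_eq; lra) (eps / (Rabs M + 1))) as [n0 H].
  { apply Rdiv_lt_0_compat; auto. assert (A := Rabs_pos M). lra. }
  exists n0. intros n Hn. specialize (H n Hn). assert (A := Rabs_pos M).
  assert (P : 0 < (1/2)^n) by (apply pow_lt; lra). rewrite Rabs_pos_eq in H by lra.
  apply (Rmult_lt_compat_r (Rabs M + 1)) in H; [|lra]. unfold Rdiv at 2 in H.
  rewrite Rmult_assoc, Rinv_l in H by lra. assert (L := Rle_abs M). nra.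
Qed.

Lemma iterate_limit : exists w : R -> R, nonpos_cont w /\
  forall n s, Rabs (w s - iterate n s) <= 4 * (1 / 2) ^ n * exp (s ^ 2).
Proof.
  set (w := fun s => real (Lim_seq (fun n => iterate n s))).
  assert (Hlim : forall s, is_lim_seq (fun n => iterate n s) (w s)).
  { intro s. apply Lim_seq_correct'. apply ex_lim_seq_cauchy_corr. intro eps.
    destruct (half_pow_small (4 * exp (s ^ 2)) (eps / 2)) as [n0 H]; [assert (P := cond_pos eps); lra|].
    exists n0.
    assert (G : forall n, (n0 <= n)%nat -> Rabs (iterate n s - iterate n0 s) < eps / 2).
    { intros n Hn. replace n with ((n - n0) + n0)%nat by lia.
      assert (B := iterate_cauchy n0 (n - n0) s). specialize (H n0 (le_n _)). lra. }
    intros n m Hn Hm. assert (G1 := G n Hn). assert (G2 := G m Hm).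
    apply Rabs_def2 in G1. apply Rabs_def2 in G2. apply Rabs_def1; lra. }
  assert (Hb : forall n s, Rabs (w s - iterate n s) <= 4 * (1 / 2) ^ n * exp (s ^ 2)).
  { intros n s. assert (Hl : is_lim_seq (fun k => iterate (k + n) s) (w s)).
    { apply (is_lim_seq_incr_n (fun k => iterate k s)), Hlim. }
    assert (B := fun k => iterate_cauchy n k s).
    apply Rabs_le_between. split.
    - enough (iterate n s - 4 * (1 / 2) ^ n * exp (s ^ 2) <= w s) by lra.
      apply (is_lim_seq_le (fun _ => iterate n s - 4 * (1 / 2) ^ n * exp (s ^ 2))
               (fun k => iterate (k + n) s) (Finite _) (Finite _)); [|apply is_lim_seq_const|auto].
      intro k. specialize (B k). apply Rabs_le_between in B. lra.
    - enough (w s <= iterate n s + 4 * (1 / 2) ^ n * exp (s ^ 2)) by lra.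
      apply (is_lim_seq_le (fun k => iterate (k + n) s)
               (fun _ => iterate n s + 4 * (1 / 2) ^ n * exp (s ^ 2)) (Finite _) (Finite _)); [|auto|apply is_lim_seq_const].
      intro k. specialize (B k). apply Rabs_le_between in B. lra. }
  exists w. split; [split|auto].
  (* The weight is unbounded, so convergence is uniform only locally; [M] bounds the weight on the
     unit ball around x. *)
  - intro x. assert (P1 : 0 < 1) by lra.
    apply (CVU_continuity iterate w x (mkposreal 1 P1)).
    + intros eps He. set (M := exp ((Rabs x + 1) ^ 2)).
      destruct (half_pow_small (4 * M) eps He) as [n0 H].
      exists n0. intros n y Hn Hy. unfold Boule in Hy. simpl in Hy.
      eapply Rle_lt_trans; [apply Hb|]. eapply Rle_lt_trans; [|apply (H n Hn)].
      assert (Ey : exp (y ^ 2) <= M).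
      { assert (Hy2 : y ^ 2 <= (Rabs x + 1) ^ 2).
        { rewrite <- (pow2_abs y). apply pow_incr. split; [apply Rabs_pos|]. split_Rabs; lra. }
        unfold M. destruct (Req_dec (y ^ 2) ((Rabs x + 1) ^ 2)) as [->|n']; [lra|].
        left; apply exp_increasing. lra. }
      assert (0 < (1 / 2) ^ n) by (apply pow_lt; lra). nra.
    + intros; apply iterate_nonpos_cont.
    + unfold Boule; simpl. rewrite Rminus_diag, Rabs_R0. lra.
  - intro x. apply (is_lim_seq_le (fun n => iterate n x) (fun _ => 0) (Finite _) (Finite _));
      [intro; apply iterate_nonpos_cont|auto|apply is_lim_seq_const].
Qed.

(** Both [w s] and [picard w s] are within a multiple of 2^(-n) of [iterate (S n) s]. *)
Lemma picard_fixed_point : exists w, nonpos_cont w /\ forall s, 0 <= s -> w s = picard w s.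
Proof.
  destruct iterate_limit as [w [Hw Hb]]. exists w. split; auto. intros s Hs.
  apply cond_eq. intros eps He.
  destruct (half_pow_small (4 * exp (s ^ 2)) eps He) as [n H]. specialize (H n (le_n _)).
  assert (B1 := Hb (S n) s).
  assert (B2 := picard_contraction w (iterate n) (4 * (1/2)^n) s Hw (iterate_nonpos_cont n) Hs (Hb n)).
  simpl iterate in B1. rewrite (Rabs_pos_eq s) in B1 by auto. simpl pow in *.
  replace (w s - picard w s) with ((w s - picard (iterate n) s) - (picard w s - picard (iterate n) s)) by ring.
  eapply Rle_lt_trans; [apply Rabs_triang|]. rewrite Rabs_Ropp. lra.
Qed.

Definition emden_solution (w w1 w2 : R -> R) : Prop :=
  (forall s, is_derive w s (w1 s)) /\
  (forall s, continuity_pt w1 s) /\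
  (forall s, 0 < s -> is_derive w1 s (w2 s) /\ w2 s + 2 / s * w1 s + exp (w s) = 0) /\
  w 0 = 0 /\ w1 0 = 0 /\ (forall s, 0 < s -> w1 s < 0).

Lemma emden_solution_exists : exists w w1 w2, emden_solution w w1 w2.
Proof.
  destruct picard_fixed_point as [h [Hh Hfix]].
  (* [picard h] replaces [h]: it is differentiable across 0, and the two are known to agree only for
     s >= 0. *)
  exists (picard h), (picard' h), (fun s => - (2 / s * picard' h s) - exp (h s)).
  split; [|split; [|split; [|split; [|split]]]].
  - intro; apply is_derive_picard, Hh.
  - intro; apply picard'_cont, Hh.
  - intros s Hs. split; [apply is_derive_picard'; [auto|lra]|].
    rewrite <- (Hfix s) by lra. ring.
  - apply picard_0.
  - unfold picard'. rewrite mom_0. unfold Rdiv. ring.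
  - intros s Hs. unfold picard'. assert (P := mom_pos 2 h s Hh Hs).
    assert (0 < s ^ 2) by (apply pow_lt; lra).
    assert (0 < mom 2 h s / s ^ 2) by (apply Rdiv_lt_0_compat; auto). lra.
Qed.

Lemma emden_solution_orbit w w1 w2 : emden_solution w w1 w2 ->
  emden_orbit (fun t => - (exp t * w1 (exp t))) (fun t => exp t ^ 2 * exp (w (exp t))).
Proof.
  intros (Hw & Hc & He & H0 & H10 & Hneg).
  split; [|split; [|split; [|split]]].
  - intro t. destruct (He (exp t) (exp_pos t)) as [D E].
    auto_derive; [repeat split; eexists; eauto|]. rewrite_derive D.
    replace (w2 (exp t)) with (- (2 / exp t * w1 (exp t)) - exp (w (exp t))) by lra.
    assert (P := exp_pos t). field. lra.
  - intro t. specialize (Hw (exp t)).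
    auto_derive; [repeat split; eexists; eauto|]. rewrite_derive Hw. simpl. ring.
  - intro t. assert (P := exp_pos t). specialize (Hneg _ P). nra.
  - intro t. apply Rmult_lt_0_compat; [apply pow_lt|]; apply exp_pos.
  - intros eps Heps.
    assert (C1 : continuity_pt (fun s => - (s * w1 s)) 0).
    { apply continuity_pt_opp, continuity_pt_mult; [apply continuity_pt_id|auto]. }
    assert (C2 : continuity_pt (fun s => s ^ 2 * exp (w s)) 0).
    { apply continuity_pt_mult; [apply derivable_continuous_pt, derivable_pt_pow|].
      apply (continuity_pt_comp w exp); [eapply is_derive_cont; apply Hw|].
      apply derivable_continuous_pt, derivable_pt_exp. }
    destruct (C1 eps Heps) as [d1 [P1 D1]]. destruct (C2 eps Heps) as [d2 [P2 D2]].
    assert (Pm : 0 < Rmin d1 d2 / 2) by (assert (P := Rmin_pos d1 d2 P1 P2); lra).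
    assert (L1 := Rmin_l d1 d2). assert (L2 := Rmin_r d1 d2).
    exists (ln (Rmin d1 d2 / 2)). intros t Ht.
    assert (Pt := exp_pos t).
    assert (Et : exp t <= Rmin d1 d2 / 2).
    { rewrite <- (exp_ln (Rmin d1 d2 / 2)) by auto.
      destruct (Req_dec t (ln (Rmin d1 d2 / 2))) as [->|n]; [lra|left; apply exp_increasing; lra]. }
    assert (Hx : forall d, Rmin d1 d2 <= d -> 0 < d -> D_x no_cond 0 (exp t) /\ Rdist (exp t) 0 < d).
    { intros d Hd Pd. split; [split; [exact I|lra]|]. unfold Rdist. rewrite Rminus_0_r, Rabs_pos_eq; lra. }
    specialize (D1 _ (Hx d1 L1 P1)). specialize (D2 _ (Hx d2 L2 P2)).
    simpl in D1, D2. unfold Rdist in D1, D2. apply Rabs_def2 in D1. apply Rabs_def2 in D2.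
    simpl. lra.
Qed.

(** * The boundary value problem *)

(** Composing with this 1-Lipschitz retraction onto [0,b] turns continuity relative to the interval
    into continuity on R. *)
Definition clamp (b x : R) : R := Rmax 0 (Rmin x b).

Lemma clamp_dom b x : 0 < b -> dom b (clamp b x).
Proof.
  intros Hb. unfold dom, clamp, Rmax, Rmin.
  destruct (Rle_dec x b); destruct (Rle_dec 0 _); lra.
Qed.

Lemma clamp_id b x : dom b x -> clamp b x = x.
Proof.
  unfold dom, clamp, Rmax, Rmin. intros [H1 H2].
  destruct (Rle_dec x b); destruct (Rle_dec 0 _); lra.
Qed.

Lemma clamp_lipschitz b x y : Rabs (clamp b x - clamp b y) <= Rabs (x - y).
Proof.
  unfold clamp, Rmax, Rmin.
  destruct (Rle_dec x b); destruct (Rle_dec y b);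
  destruct (Rle_dec 0 x); destruct (Rle_dec 0 y); destruct (Rle_dec 0 b); split_Rabs; lra.
Qed.

Lemma clamp_cont b f : 0 < b -> (forall x, dom b x -> continue_in f (dom b) x) ->
  forall x, continuity_pt (fun x => f (clamp b x)) x.
Proof.
  intros Hb Hf x eps He.
  destruct (Hf (clamp b x) (clamp_dom b x Hb) eps He) as [d [Pd Hd]].
  exists d. split; auto. intros z [_ Hz]. simpl in *. unfold Rdist in *.
  destruct (Req_dec (clamp b z) (clamp b x)) as [->|n].
  - rewrite Rminus_diag, Rabs_R0. auto.
  - apply Hd. split.
    + split; [apply clamp_dom; auto|auto].
    + eapply Rle_lt_trans; [apply clamp_lipschitz|auto].
Qed.

Lemma clamp_derive b f f' x : 0 < x < b -> D_in f f' (dom b) x ->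
  is_derive (fun x => f (clamp b x)) x (f' x).
Proof.
  intros Hx Hf. apply is_derive_Reals. intros eps He.
  destruct (Hf eps He) as [d [Pd Hd]].
  assert (Pm : 0 < Rmin d (Rmin x (b - x))) by (repeat apply Rmin_pos; lra).
  exists (mkposreal _ Pm). simpl. intros h Hh Hhm.
  assert (L1 := Rmin_l d (Rmin x (b - x))). assert (L2 := Rmin_r d (Rmin x (b - x))).
  assert (L3 := Rmin_l x (b - x)). assert (L4 := Rmin_r x (b - x)).
  assert (Hb := Rabs_def2 h _ Hhm).
  rewrite !clamp_id by (unfold dom; lra).
  specialize (Hd (x + h)). simpl in Hd. unfold Rdist in Hd.
  replace (x + h - x) with h in Hd by ring. apply Hd.
  split; [|lra]. unfold D_x, dom. lra.
Qed.

Lemma D_in_of_derive f f' D x : is_derive f x (f' x) -> D_in f f' D x.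
Proof.
  intros H. apply is_derive_Reals in H.
  assert (G := proj2 (derivable_pt_lim_D_in f f' x) H).
  intros eps He. destruct (G eps He) as [d [Pd Hd]]. exists d. split; auto.
  intros z [[_ Hz] Hz2]. apply Hd. split; [split; [exact I|auto]|auto].
Qed.

Lemma continue_in_of_cont f D x : continuity_pt f x -> continue_in f D x.
Proof.
  intros H eps He. destruct (H eps He) as [d [Pd Hd]]. exists d. split; auto.
  intros z [[_ Hz] Hz2]. apply Hd. split; [split; [exact I|auto]|auto].
Qed.

Lemma D_in_continue_in f f' D x : D_in f f' D x -> continue_in f D x.
Proof. intros H. exact (cont_deriv f f' D x H). Qed.

(** [is_solution] without the condition at [P4]: the singular initial value problem, with [y 0] as
    its free parameter. *)
Definition regular_solution (P1 P4 : R) (y y1 y2 : R -> R) : Prop :=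
  (forall x, dom P4 x -> D_in y y1 (dom P4) x /\ continue_in y1 (dom P4) x) /\
  (forall x, 0 < x <= P4 ->
     D_in y1 y2 (dom P4) x /\ y2 x + 2 / x * y1 x + P1 * exp (y x) = 0) /\
  y1 0 = 0.

(* The friction term -4/x d'^2 has a good sign, so d^2 + d'^2 satisfies a
   Gronwall inequality in spite of the singularity at 0. *)
Lemma regular_solution_unique P1 P4 y y1 y2 z z1 z2 : 0 < P1 -> 0 < P4 ->
  regular_solution P1 P4 y y1 y2 -> regular_solution P1 P4 z z1 z2 -> y 0 = z 0 ->
  forall x, dom P4 x -> y x = z x /\ y1 x = z1 x.
Proof.
  intros HP1 HP4 (Hy & Hy2 & Hy0) (Hz & Hz2 & Hz0) H0.
  set (Y := fun x => y (clamp P4 x)). set (Y1 := fun x => y1 (clamp P4 x)).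
  set (Z := fun x => z (clamp P4 x)). set (Z1 := fun x => z1 (clamp P4 x)).
  assert (CY : forall x, continuity_pt Y x).
  { apply clamp_cont; auto. intros x Hx. eapply D_in_continue_in. apply Hy; auto. }
  assert (CZ : forall x, continuity_pt Z x).
  { apply clamp_cont; auto. intros x Hx. eapply D_in_continue_in. apply Hz; auto. }
  assert (CY1 : forall x, continuity_pt Y1 x) by (apply clamp_cont; auto; intros; apply Hy; auto).
  assert (CZ1 : forall x, continuity_pt Z1 x) by (apply clamp_cont; auto; intros; apply Hz; auto).
  destruct (continuity_ab_maj Y 0 P4) as [my [My _]]; [lra|auto|].
  destruct (continuity_ab_maj Z 0 P4) as [mz [Mz _]]; [lra|auto|].
  set (M := Rmax (Y my) (Z mz)).
  assert (BY : forall x, dom P4 x -> Y x <= M).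
  { intros x Hx. unfold M. eapply Rle_trans; [apply My, Hx|apply Rmax_l]. }
  assert (BZ : forall x, dom P4 x -> Z x <= M).
  { intros x Hx. unfold M. eapply Rle_trans; [apply Mz, Hx|apply Rmax_r]. }
  (* With d and d1 the differences of the values and of the derivatives, 2 d d1 costs 1, and the
     exponential term costs P1 times its Lipschitz constant e^M. *)
  set (C := P1 * exp M + 1).
  set (F := fun x => ((Y x - Z x) ^ 2 + (Y1 x - Z1 x) ^ 2) * exp (- (C * x))).
  set (F' := fun x => (2 * (Y x - Z x) * (Y1 x - Z1 x)
     + 2 * (Y1 x - Z1 x) * (- (2 / x * (Y1 x - Z1 x)) - P1 * (exp (Y x) - exp (Z x)))
     - C * ((Y x - Z x) ^ 2 + (Y1 x - Z1 x) ^ 2)) * exp (- (C * x))).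
  assert (DF : forall x, 0 < x < P4 -> is_derive F x (F' x)).
  { intros x Hx. assert (dx : dom P4 x) by (unfold dom; lra).
    assert (DY : is_derive Y x (y1 x)) by exact (clamp_derive P4 y y1 x Hx (proj1 (Hy x dx))).
    assert (DZ : is_derive Z x (z1 x)) by exact (clamp_derive P4 z z1 x Hx (proj1 (Hz x dx))).
    destruct (Hy2 x ltac:(lra)) as [Dy Ey]. destruct (Hz2 x ltac:(lra)) as [Dz Ez].
    assert (DY1 : is_derive Y1 x (y2 x)) by exact (clamp_derive P4 y1 y2 x Hx Dy).
    assert (DZ1 : is_derive Z1 x (z2 x)) by exact (clamp_derive P4 z1 z2 x Hx Dz).
    assert (EY : Y x = y x) by (unfold Y; rewrite clamp_id; auto).
    assert (EZ : Z x = z x) by (unfold Z; rewrite clamp_id; auto).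
    assert (EY1 : Y1 x = y1 x) by (unfold Y1; rewrite clamp_id; auto).
    assert (EZ1 : Z1 x = z1 x) by (unfold Z1; rewrite clamp_id; auto).
    rewrite <- EY1 in DY, Ey. rewrite <- EZ1 in DZ, Ez. rewrite <- EY in Ey. rewrite <- EZ in Ez.
    replace (y2 x) with (- (2 / x * Y1 x) - P1 * exp (Y x)) in DY1 by lra.
    replace (z2 x) with (- (2 / x * Z1 x) - P1 * exp (Z x)) in DZ1 by lra.
    unfold F, F'. auto_derive.
    - repeat split; eexists; eauto.
    - rewrite_derive DY; rewrite_derive DZ; rewrite_derive DY1; rewrite_derive DZ1. simpl; field. lra. }
  assert (NF : forall x, dom P4 x -> F' x <= 0).
  { intros x Hx. unfold F'. assert (P := exp_pos (- (C * x))).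
    assert (L := exp_lipschitz M (Y x) (Z x) (BY x Hx) (BZ x Hx)).
    set (d := Y x - Z x) in *. set (d1 := Y1 x - Z1 x) in *. set (e := exp (Y x) - exp (Z x)) in *.
    (* The mean value point used below may be an end of the interval. At x = 0 the term is 0
       whatever [2 / 0] is, since both derivatives vanish there. *)
    assert (Fr : 0 <= 2 / x * d1 * d1).
    { destruct Hx as [Hx0 _]. destruct (Req_dec x 0) as [E|n].
      - replace d1 with 0. lra. unfold d1, Y1, Z1. subst x. rewrite clamp_id; [lra|unfold dom; lra].
      - rewrite Rmult_assoc. apply Rmult_le_pos; [left; apply Rdiv_lt_0_compat; lra|nra]. }
    assert (PM := exp_pos M).
    assert (Cr : - (2 * d1 * e) <= exp M * (d ^ 2 + d1 ^ 2)).
    { apply Rle_trans with (2 * (Rabs d1 * Rabs e)).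
      - rewrite <- Rabs_mult. split_Rabs; lra.
      - apply Rle_trans with (2 * (Rabs d1 * (exp M * Rabs d))).
        + assert (Rabs d1 * Rabs e <= Rabs d1 * (exp M * Rabs d)) by (apply Rmult_le_compat_l; [apply Rabs_pos|auto]). lra.
        + rewrite <- (pow2_abs d), <- (pow2_abs d1). assert (0 <= (Rabs d - Rabs d1) ^ 2) by apply pow2_ge_0. nra. }
    assert (Mx : 2 * d * d1 <= d ^ 2 + d1 ^ 2) by (assert (0 <= (d - d1) ^ 2) by apply pow2_ge_0; nra).
    apply (Rmult_le_compat_l P1) in Cr; [|lra].
    assert (G : 2 * d * d1 + 2 * d1 * (- (2 / x * d1) - P1 * e) - C * (d ^ 2 + d1 ^ 2) <= 0).
    { unfold C. lra. }
    nra. }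
  assert (F0 : F 0 = 0).
  { assert (d0 : dom P4 0) by (unfold dom; lra).
    unfold F, Y, Z, Y1, Z1. rewrite !clamp_id by auto. rewrite H0, Hy0, Hz0. ring. }
  intros x Hx.
  assert (Fx : F x <= 0).
  { destruct (MVT_gen F 0 x F') as [c [Ic Ec]].
    - intros c Hc. apply DF. unfold dom in Hx. rewrite Rmin_left, Rmax_right in Hc; lra.
    - intros c _. unfold F. apply continuity_pt_mult; [apply continuity_pt_plus|].
      + apply (continuity_pt_comp (fun x => Y x - Z x) (fun x => x ^ 2)).
        apply continuity_pt_minus; auto. apply derivable_continuous_pt, derivable_pt_pow.
      + apply (continuity_pt_comp (fun x => Y1 x - Z1 x) (fun x => x ^ 2)).
        apply continuity_pt_minus; auto. apply derivable_continuous_pt, derivable_pt_pow.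
      + apply derivable_continuous_pt. apply ex_derive_Reals_0. auto_derive. auto.
    - unfold dom in Hx. rewrite Rmin_left, Rmax_right in Ic by lra.
      assert (N := NF c ltac:(unfold dom; lra)). rewrite F0 in Ec. nra. }
  unfold F, Y, Z, Y1, Z1 in Fx. rewrite !clamp_id in Fx by auto.
  assert (P := exp_pos (- (C * x))).
  assert (S1 := pow2_ge_0 (y x - z x)). assert (S2 := pow2_ge_0 (y1 x - z1 x)).
  assert (S : (y x - z x) ^ 2 + (y1 x - z1 x) ^ 2 <= 0) by (apply Rmult_le_reg_r with (exp (- (C * x))); lra).
  split; apply Rminus_diag_uniq, Rsqr_0_uniq; unfold Rsqr; lra.
Qed.

(** The factor l = e^t / P4 sends x = P4 to s = e^t, so the slope at P4 is -u(t)/P4. *)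
Definition scaled (P1 P4 : R) (w : R -> R) (t x : R) : R :=
  ln ((exp t / P4) ^ 2 / P1) + w (exp t / P4 * x).

Lemma scaled_regular P1 P4 w w1 w2 t : 0 < P1 -> 0 < P4 -> emden_solution w w1 w2 ->
  regular_solution P1 P4 (scaled P1 P4 w t) (fun x => exp t / P4 * w1 (exp t / P4 * x))
    (fun x => (exp t / P4) ^ 2 * w2 (exp t / P4 * x)).
Proof.
  intros HP1 HP4 (Hw & Hc & He & H0 & H10 & _). unfold scaled.
  assert (Pl : 0 < exp t / P4) by (apply Rdiv_lt_0_compat; [apply exp_pos|auto]).
  set (l := exp t / P4) in *.
  split; [|split].
  - intros x Hx. split.
    + apply D_in_of_derive. specialize (Hw (l * x)).
      auto_derive; [repeat split; eexists; eauto|]. rewrite_derive Hw. ring.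
    + apply continue_in_of_cont. apply continuity_pt_scal.
      apply (continuity_pt_comp (fun x => l * x) w1); auto.
      apply continuity_pt_scal, continuity_pt_id.
  - intros x Hx. assert (Plx : 0 < l * x) by (apply Rmult_lt_0_compat; lra).
    destruct (He (l * x) Plx) as [D E]. split.
    + apply D_in_of_derive.
      auto_derive; [repeat split; eexists; eauto|]. rewrite_derive D. ring.
    + rewrite exp_plus, exp_ln by (apply Rdiv_lt_0_compat; [apply pow_lt|]; auto).
      replace (w2 (l * x)) with (- (2 / (l * x) * w1 (l * x)) - exp (w (l * x))) by lra.
      field. lra.
  - rewrite Rmult_0_r, H10. ring.
Qed.

Lemma scaled_0 P1 P4 w w1 w2 t : emden_solution w w1 w2 ->
  scaled P1 P4 w t 0 = ln ((exp t / P4) ^ 2 / P1).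
Proof. intros (_ & _ & _ & H0 & _). unfold scaled. rewrite Rmult_0_r, H0. ring. Qed.

Lemma scaled_inj P1 P4 w w1 w2 s t : 0 < P1 -> 0 < P4 -> emden_solution w w1 w2 ->
  same_on P4 (scaled P1 P4 w s) (scaled P1 P4 w t) -> s = t.
Proof.
  intros HP1 HP4 Hw Hs. specialize (Hs 0 ltac:(unfold dom; lra)).
  rewrite !(scaled_0 _ _ _ _ _ _ Hw) in Hs.
  assert (Ps : 0 < exp s / P4) by (apply Rdiv_lt_0_compat; [apply exp_pos|auto]).
  assert (Pt : 0 < exp t / P4) by (apply Rdiv_lt_0_compat; [apply exp_pos|auto]).
  apply ln_inv in Hs; try (apply Rdiv_lt_0_compat; [apply pow_lt|]; auto).
  assert (E : (exp s / P4) ^ 2 = (exp t / P4) ^ 2).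
  { apply (Rmult_eq_reg_r (/ P1)); [exact Hs|]. apply Rinv_neq_0_compat; lra. }
  assert (E2 : exp s / P4 = exp t / P4) by nra.
  apply exp_inv. apply (Rmult_eq_reg_r (/ P4)); [exact E2|]. apply Rinv_neq_0_compat; lra.
Qed.

Lemma scaled_solution P1 P4 w w1 w2 t : 0 < P1 -> 0 < P4 -> emden_solution w w1 w2 ->
  is_solution P1 P4 (- (exp t * w1 (exp t))) (scaled P1 P4 w t).
Proof.
  intros HP1 HP4 Hw. destruct (scaled_regular P1 P4 w w1 w2 t HP1 HP4 Hw) as (A & B & C).
  eexists; eexists. split; [exact A|]. split; [exact B|]. split; [exact C|].
  replace (exp t / P4 * P4) with (exp t) by (field; lra). field. lra.
Qed.

Lemma solution_scaled P1 P4 N w w1 w2 y : 0 < P1 -> 0 < P4 -> emden_solution w w1 w2 ->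
  is_solution P1 P4 N y ->
  exists t, - (exp t * w1 (exp t)) = N /\ same_on P4 y (scaled P1 P4 w t).
Proof.
  intros HP1 HP4 Hw (y1 & y2 & A & B & C & D).
  assert (Q : 0 < P1 * exp (y 0)) by (apply Rmult_lt_0_compat; [auto|apply exp_pos]).
  assert (Qs := sqrt_lt_R0 _ Q).
  (* This t solves P1 e^(y 0) = l^2 with l = e^t / P4, which matches the value at 0. *)
  exists (ln (P4 * sqrt (P1 * exp (y 0)))). set (t := ln _).
  assert (Et : exp t = P4 * sqrt (P1 * exp (y 0))) by (apply exp_ln, Rmult_lt_0_compat; auto).
  assert (E0 : y 0 = scaled P1 P4 w t 0).
  { rewrite (scaled_0 _ _ _ _ _ _ Hw), Et.
    replace (P4 * sqrt (P1 * exp (y 0)) / P4) with (sqrt (P1 * exp (y 0))) by (field; lra).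
    rewrite pow2_sqrt by lra. replace (P1 * exp (y 0) / P1) with (exp (y 0)) by (field; lra).
    now rewrite ln_exp. }
  assert (U := regular_solution_unique P1 P4 y y1 y2 _ _ _ HP1 HP4 (conj A (conj B C))
                 (scaled_regular P1 P4 w w1 w2 t HP1 HP4 Hw) E0).
  split; [|intros x Hx; apply U, Hx].
  destruct (U P4 ltac:(unfold dom; lra)) as [_ E]. rewrite D in E.
  replace (exp t / P4 * P4) with (exp t) in E by (field; lra).
  apply (Rmult_eq_reg_r (/ P4)); [unfold Rdiv in E; lra|]. apply Rinv_neq_0_compat; lra.
Qed.

(* Stdlib world. In (b), N = N2 is the turning point of the solution branch:
   the solution there is unique as well. *)
Theorem theorem2 :
  exists N1 N2 : R, 0 < N1 /\ N1 < 2 /\ 2 < N2 /\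
    forall P1 P4 : R, 0 < P1 -> 0 < P4 ->
      (forall N : R, 0 < N -> (has_solution P1 P4 N <-> N <= N2)) /\
      (forall N : R, 0 < N ->
         (has_unique_solution P1 P4 N <-> (0 < N < N1 \/ N = N2))) /\
      (forall K : nat, (0 < K)%nat ->
         exists delta : R, 0 < delta /\
           forall N : R, 0 < N -> 0 < Rabs (N - 2) < delta ->
             has_at_least_solutions K P1 P4 N).
Proof.
  destruct emden_solution_exists as (w & w1 & w2 & Hw).
  assert (H := emden_solution_orbit w w1 w2 Hw).
  assert (Hsol := fun P1 P4 t HP1 HP4 => scaled_solution P1 P4 w w1 w2 t HP1 HP4 Hw).
  assert (Hscaled := fun P1 P4 N y HP1 HP4 => solution_scaled P1 P4 N w w1 w2 y HP1 HP4 Hw).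
  set (u := fun t => - (exp t * w1 (exp t))) in *.
  set (v := fun t => exp t ^ 2 * exp (w (exp t))) in *.
  assert (Hcont : forall x, continuity_pt u x) by (intro; eapply u_cont; eauto).
  destruct (orbit_shape u v H) as (a & t1 & t2 & H12 & Hu12 & Hmax & Hmin & Hinc).
  (* u tends to 0 at -oo, so the rise to the maximum takes every value in (0, N2]. *)
  assert (Hearly : forall N, 0 < N <= u t1 -> exists t, t <= t1 /\ u t = N).
  { intros N HN. destruct (proj2 (proj2 (proj2 (proj2 H))) N (proj1 HN)) as [T HT].
    assert (L1 := Rmin_l T t1). assert (L2 := Rmin_r T t1).
    destruct (HT (Rmin T t1) L1) as [UT _].
    destruct (ivt_value u (Rmin T t1) t1 N L2 Hcont) as [t [It Et]]; [nra|].
    exists t; split; [lra|auto]. }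
  exists (u t2), (u t1).
  split; [apply H|]. split; [lra|]. split; [lra|].
  intros P1 P4 HP1 HP4. split; [|split].
  - intros N HN. split.
    + intros [y Hy]. destruct (Hscaled P1 P4 N y HP1 HP4 Hy) as [t [<- _]].
      destruct (Req_dec t t1) as [->|n]; [apply Rle_refl|]. left. apply (Hmax t n).
    + intros HN2. destruct (Hearly N) as [t [_ <-]]; [lra|].
      exists (scaled P1 P4 w t). apply Hsol; auto.
  - intros N HN.
    assert (Huniq : forall t, u t = N -> (forall s, u s = N -> s = t) -> has_unique_solution P1 P4 N).
    { intros t Et Ht. exists (scaled P1 P4 w t). split.
      - rewrite <- Et. apply Hsol; auto.
      - intros z Hz. destruct (Hscaled P1 P4 N z HP1 HP4 Hz) as [s [Es Ss]].
        rewrite (Ht s Es) in Ss. intros x Hx. symmetry. auto. }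
    split.
    + intros [y [Hy Hy']].
      destruct (Hscaled P1 P4 N y HP1 HP4 Hy) as [t [Et St]]. fold (u t) in Et.
      destruct (Req_dec t t1) as [->|n]; [right; auto|]. left. split; auto.
      destruct (Rlt_le_dec N (u t2)) as [|h]; auto. exfalso.
      assert (HN1 := Hmax t n).
      (* For N1 <= N < N2 the value N is taken once up to t1 and once on [t1,t2]; the two times
         could coincide only at t1, where u = N2. *)
      destruct (Hearly N) as [r [Ir Er]]; [lra|].
      destruct (ivt_value u t1 t2 N) as [s [Is Es]]; auto; [lra|nra|].
      assert (Hrs : r = s).
      { apply (scaled_inj P1 P4 w w1 w2); auto. intros x Hx.
        transitivity (y x); [symmetry|]; apply Hy'; auto.
        - rewrite <- Er. apply Hsol; auto.
        - rewrite <- Es. apply Hsol; auto. }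
      assert (Er1 : r = t1) by lra. rewrite Er1 in Er. lra.
    + intros [[_ HN1]| ->].
      * destruct (Hearly N) as [t [_ Et]]; [lra|].
        (* From [a] on, u is at least N1, so a value below N1 is taken only where u is strictly
           increasing. *)
        assert (Hbefore : forall s, u s = N -> s < a).
        { intros s Es. destruct (Rlt_le_dec s a) as [|h]; auto. specialize (Hmin s h). lra. }
        apply (Huniq t Et). intros s Es.
        assert (B1 := Hbefore s Es). assert (B2 := Hbefore t Et).
        destruct (Rtotal_order s t) as [o|[o|o]]; auto.
        -- assert (L := Hinc s t o). lra.
        -- assert (L := Hinc t s o). lra.
      * apply (Huniq t1 eq_refl). intros s Es. destruct (Req_dec s t1) as [|n]; auto.
        assert (L := Hmax s n). lra.
  (* The starting time 0 is arbitrary; distinct crossing times give distinct values at x = 0. *)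
  - intros K _. destruct (many_crossings u v K H 0) as [delta [Hd HK]].
    exists delta. split; auto. intros N _ HN.
    destruct (HK N) as [ts [Hts Hord]]; [lra|].
    exists (fun i => scaled P1 P4 w (ts i)). split.
    + intros i Hi. destruct (Hts i Hi) as [_ <-]. apply Hsol; auto.
    + intros i j Hi Hj Hij Hsame.
      assert (E : ts i = ts j) by (apply (scaled_inj P1 P4 w w1 w2); auto).
      destruct (Nat.lt_total i j) as [o|[o|o]]; auto.
      * assert (L := Hord i j ltac:(lia)). lra.
      * assert (L := Hord j i ltac:(lia)). lra.
Qed.
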